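(* Let $n\ge 2$, let $T_0$ be the standard tiling, and take indeterminates $z_u$ indexed by the vertices $v\neq v_0$ and the rhombi of $T_0$; set $z_{v_0}=1$. Let $A$ be the $n\times n$ matrix with entries in the field of rational functions in these indeterminates such that the network of $A$ on $T_0$ is $u\mapsto z_u$. Then every entry of $A$ is a Laurent polynomial in the indeterminates $z_u$, with all coefficients of occurring monomials equal to $1$. Moreover, for all $i,j\in[n]$, the monomials of $A_{ij}$ are in bijection with the domino tilings of the following region (a half-aztec diamond from which two squares have been removed): if $i\le j$, the region obtained from the half-aztec diamond of order $n$ by deleting the squares of the bottom row at positions $2i-1$ and $2j$; if $i>j$, the region obtained from the half-aztec diamond of order $n$ by deleting the leftmost and the rightmost square of every row (the outer layer) and also deleting the squares of the bottom row at positions $2i-1$ and $2j$ (positions numbered in the original bottom row).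
   Context: $[n]=\{1,\dots,n\}$. For a matrix $A$ and $X,Y\subseteq[n]$ with $|X|=|Y|$, $A_X^Y$ is the submatrix with rows $X$ and columns $Y$ in increasing order; the empty determinant is 1. Standard tiling: let $e_j=e^{\pi i(j-1)/n}\in\mathbb{R}^2$ for $j\in[n]$ and let $P_n$ be the regular $2n$-gon with unit edges which is the convex hull of $\{\sum_{j\in S}e_j:S\subseteq[n]\}$, with $v_0=0$. The standard tiling $T_0$ of $P_n$ by rhombi has vertices exactly the points $v_G=\sum_{j\in G}e_j$, where $G$ is a (possibly empty) set of consecutive elements of $[n]$ (with $v_\emptyset=v_0$), and for each $i<j$ exactly one rhombus $R_{ij}$, with vertices $v_S,\ v_S+e_i,\ v_S+e_i+e_j,\ v_S+e_j$ where $S=\{i+1,\dots,j-1\}$. The network of $A$ on $T_0$ is the function with value $(-1)^{\lfloor |G|/2\rfloor}\det A_G^G$ at the vertex $v_G$ and value $(-1)^{\lfloor (|S|+1)/2\rfloor}\det A_{S\cup\{j\}}^{S\cup\{i\}}$ at the rhombus $R_{ij}$, $i<j$, $S=\{i+1,\dots,j-1\}$. There is exactly one matrix $A$ over the field of rational functions whose network is the given assignment $z$. Half-aztec diamond of order $n$: the region consisting of $n$ horizontal rows of unit squares stacked with centers aligned, the bottom row having $2n$ squares (numbered $1,\dots,2n$ from left to right) and each successive row above having two fewer squares (one fewer on each side), so that the top row has 2 squares. A domino is a union of two edge-adjacent unit squares; a domino tiling of a region is a partition of its squares into dominoes (the empty region has exactly one domino tiling). *)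

(* Defs.v *)
From HB Require Import structures.
From mathcomp Require Import all_boot all_order all_algebra finmap.
From mathcomp Require Import mpoly.

Set Implicit Arguments.
Unset Strict Implicit.
Unset Printing Implicit Defensive.

Import GRing.Theory.
Local Open Scope ring_scope.

(* The index set [n] = {1, ..., n} is rendered as 'I_n, so k : 'I_n stands for *)
(* the element k.+1 of [n].                                                    *)

(** Standard tiling *)

(* The vertex v_G of the standard tiling is represented by the set G itself:   *)
(* since e_1, ..., e_n are unit vectors of strictly increasing arguments       *)
(* 0, pi/n, ..., (n-1)pi/n, distinct sets G of consecutive elements have       *)
(* distinct v_G (an interval is determined by the length and the argument of   *)
(* v_G). The empty set is consecutive (a = b) and represents v_0.              *)
Definition consecutive n (G : {set 'I_n}) : bool :=
  [exists a : 'I_n.+1, [exists b : 'I_n.+1,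
    G == [set k : 'I_n | (a <= k < b)%N]]].

Definition vertex n := {G : {set 'I_n} | consecutive G}.

(* The pair (i, j) represents the rhombus R_ij. *)
Definition rhombus n := {p : 'I_n * 'I_n | (p.1 < p.2)%N}.

Definition cell n := (vertex n + rhombus n)%type.

Definition between n (i j : 'I_n) : {set 'I_n} := [set k : 'I_n | (i < k < j)%N].

Lemma consecutive0 n : consecutive (set0 : {set 'I_n}).
Proof.
apply/existsP; exists ord0; apply/existsP; exists ord0.
by apply/eqP/setP=> k; rewrite !inE.
Qed.

Definition v0 n : cell n := inl (exist _ set0 (consecutive0 n)).

(** Networks *)

(* A_X^Y: enum_val lists the elements of a subset of 'I_n in increasing order. *)
Definition submatrix (K : Type) n (A : 'M[K]_n) (X Y : {set 'I_n}) :
    'M[K]_(#|X|, #|Y|) :=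
  mxsub enum_val enum_val A.

Lemma card_between_sides n (i j : 'I_n) :
  #|i |: between i j| = #|j |: between i j|.
Proof. by rewrite !cardsU1 !inE !ltnn andbF. Qed.

Definition network (K : comPzRingType) n (A : 'M[K]_n) (u : cell n) : K :=
  match u with
  | inl v =>
      let G := sval v in (-1) ^+ (#|G| ./2) * \det (submatrix A G G)
  | inr r =>
      let i := (sval r).1 in let j := (sval r).2 in let S := between i j in
      (-1) ^+ (#|S|.+1 ./2) *
        \det (castmx (erefl, card_between_sides i j)
                     (submatrix A (j |: S) (i |: S)))
  end.

(** Indeterminates, rational functions and Laurent polynomials *)

Definition indet n := {u : cell n | u != v0 n}.

Definition ratfun (F : fieldType) n := {fraction {mpoly F[#|{: indet n}|]}}.

Definition ratC (F : fieldType) n (c : F) : ratfun F n := tofrac c%:MP.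

Definition ratX (F : fieldType) n (w : indet n) : ratfun F n :=
  tofrac 'X_(enum_rank w).

Definition zvar (F : fieldType) n (u : cell n) : ratfun F n :=
  if insub u is Some w then ratX F w else 1.

Definition exponent n := {ffun indet n -> int}.

Definition laurent_monomial (F : fieldType) n (e : exponent n) : ratfun F n :=
  \prod_(w : indet n) ratX F w ^ e w.

(* Finitely supported families of coefficients; the monomials occurring in L   *)
(* are those with exponent in finsupp L.                                       *)
Definition laurent_poly (F : fieldType) n :=
  {fsfun exponent n -> F for fun=> 0}.

Definition laurent_eval (F : fieldType) n (L : laurent_poly F n) : ratfun F n :=
  \sum_(e <- finsupp L) ratC n (L e) * laurent_monomial F e.

(** Domino tilings *)

(* (c, r) is the unit square in column c and row r, counted from 0 from the    *)
(* left and from the bottom; the bottom row of the half-aztec diamond of order *)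
(* n has columns 0, ..., 2n-1, so position p there is column p - 1.            *)
Definition square n := ('I_n.*2 * 'I_n)%type.

Definition adjacent n (s t : square n) : bool :=
  ((s.2 == t.2) && ((s.1.+1 == t.1 :> nat) || (t.1.+1 == s.1 :> nat))) ||
  ((s.1 == t.1) && ((s.2.+1 == t.2 :> nat) || (t.2.+1 == s.2 :> nat))).

Definition domino n (D : {set square n}) : bool :=
  [exists s, [exists t, adjacent s t && (D == [set s; t])]].

Definition domino_tilings n (R : {set square n}) : {set {set {set square n}}} :=
  [set P | partition P R & [forall D in P, domino D]].

(* Row r consists of the 2(n - r) columns r, ..., 2n - r - 1. *)
Definition half_aztec n : {set square n} :=
  [set s : square n | (s.2 <= s.1 < n.*2 - s.2)%N].

Definition outer_layer n : {set square n} :=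
  [set s : square n | (s.1 == s.2 :> nat) || (s.1.+1 == n.*2 - s.2 :> nat)%N].

(* For i, j in [n], the positions 2i - 1 and 2j become the columns 2i and      *)
(* 2j + 1 for i, j : 'I_n.                                                     *)
Definition removed_pair n (i j : 'I_n) : {set square n} :=
  [set s : square n |
     (s.2 == 0 :> nat) && ((s.1 == i.*2 :> nat) || (s.1 == j.*2.+1 :> nat))].

Definition entry_region n (i j : 'I_n) : {set square n} :=
  if (i <= j)%N then half_aztec n :\: removed_pair i j
  else (half_aztec n :\: outer_layer n) :\: removed_pair i j.

(* Main.v *)
Require Import Defs.
From mathcomp Require Import all_boot all_order all_algebra finmap.
From mathcomp Require Import mpoly.
From mathcomp Require Import ring zify.

Set Implicit Arguments.
Unset Strict Implicit.
Unset Printing Implicit Defensive.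

Import GRing.Theory.
Local Open Scope ring_scope.

(** Write M(a, b; k) for the minor of A on the k consecutive rows from a and
the k consecutive columns from b. Up to the sign (-1)^(k/2), the network
prescribes exactly the minors M(b + s, b; k) with s = 0 (vertices) and s = 1
(rhombi); they are monomials, so they are nonzero.

Fix a row i and a column b >= i, and let P(b, h) be the determinant of A on
the rows i, b+1, ..., b+h and the columns b, ..., b+h. The ratio
p(b, h) = P(b, h) / M(b, b; h+1) is 1 when b = i, whatever h is, and A_ib / A_bb
when h = 0. Two three-term determinant identities ([bordered_up],
[bordered_down]) combine into the recurrence
    p(b+1, h) = p(b+1, h-1) + H p(b, h) + D p(b, h+1),
where H and D are Laurent monomials in the prescribed minors; the signs
(-1)^(k/2) are exactly those that turn the coefficient of D from -1 to +1
([border_ratio_step]). Iterating, A_ij / A_jj is for i <= j the sum of the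
weights of the lattice paths from (i, 0) to (j, 0) in the half-plane h >= 0 with
steps (0, 1), (1, 0) and (1, -1), that is, of the Schroeder paths
([paths_sum]).

Different paths have different weights ([paths_uniq]): the step that
enters the last column is the only one that involves the minors starting there,
and the exponents of these reveal the height where it lands and its type;
induct on the number of columns. So A_ij is a sum of distinct monomials with
coefficient 1.

Entries with i > j reduce to the previous case for the matrix B_xy = A_(y+1)x
of order n - 1: transposition and shift exchange the two families of prescribed
minors, and the outer layer of the half-aztec diamond is lost.

It remains to count tilings. Colour the squares as on a chessboard and index
the black and the white squares of the half-aztec diamond by the same
triangle k + h < n, so that the white square (k, h) is adjacent to the black
squares (k, h), (k, h+1), (k+1, h) and (k+1, h-1). The last three are the
steps of the paths above, and this directed graph has no cycle. Therefore,
when the black square s and the white square t are removed, following the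
dominoes from s yields a path from s to t, and off that path each white square
is forced to be matched with the black square of the same index. Removing
the domino that covers the black square t shows that the number of tilings obeys
the recurrence of the number of paths ([card_region_paths]); equality of the two
cardinals gives the bijection. *)

(** * Bordered minors and their three-term relations *)

Section Minors.
Variables (K : fieldType) (A : nat -> nat -> K).
Implicit Types (r : nat -> K) (a b h k : nat).

Definition minor a b k : K := \det (\matrix_(i < k, j < k) A (a + i) (b + j)).

(** Keeping the first row [r] arbitrary makes the determinant a linear form in
[r]; identities between such forms are then checked on a basis of rows. *)
Definition bordered r a b h : K :=
  \det (\matrix_(i < h.+1, j < h.+1)
     (if i : nat is i'.+1 then A (a + i') else r) (b + j)%N).

Lemma minor0 a b : minor a b 0 = 1.
Proof. exact: det_mx00. Qed.

Lemma bordered0 r a b : bordered r a b 0 = r b.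
Proof. by rewrite /bordered det_mx11 mxE addn0. Qed.

Lemma bordered_row a b h : bordered (A a) a.+1 b h = minor a b h.+1.
Proof.
congr (\det _); apply/matrixP=> i j; rewrite !mxE.
by case: i => -[|i] lti //=; rewrite ?addn0 ?addSnnS.
Qed.

Lemma bordered_in a b h k : (k < h)%N -> bordered (A (a + k)) a b h = 0.
Proof.
move=> ltkh; pose i1 : 'I_h.+1 := Ordinal (ltkh : k.+1 < h.+1)%N.
by apply: (@determinant_alternate _ _ _ ord0 i1) => // j; rewrite !mxE.
Qed.

Lemma bordered_in0 a b h : bordered (A a) a b h.+1 = 0.
Proof. by have := @bordered_in a b h.+1 0 isT; rewrite addn0. Qed.

Definition border_cofactor a b h (j : 'I_h.+1) : K :=
  cofactor (\matrix_(i < h.+1, j < h.+1)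
     (if i : nat is i'.+1 then A (a + i') else fun=> 0) (b + j)%N) ord0 j.

Lemma borderedE r a b h :
  bordered r a b h = \sum_(j < h.+1) r (b + j)%N * border_cofactor a b j.
Proof.
rewrite /bordered (expand_det_row _ ord0); apply: eq_bigr => j _.
rewrite mxE; congr (_ * ((-1) ^+ _ * \det _)).
by apply/matrixP=> i l; rewrite !mxE lift0.
Qed.

Definition unit_row b : nat -> K := fun c => (c == b)%:R.

Lemma bordered_unit a b h : bordered (unit_row b) a b h = minor a b.+1 h.
Proof.
rewrite borderedE big_ord_recl big1 => [|j _]; last first.
  by rewrite /unit_row lift0 -{2}[b]addn0 eqn_add2l mul0r.
rewrite /unit_row addn0 eqxx mul1r addr0 /border_cofactor /cofactor mul1r.
by congr (\det _); apply/matrixP=> i j; rewrite !mxE !lift0 /= addSnnS.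
Qed.

Lemma bordered_unit0 a b c h : (c < b)%N -> bordered (unit_row c) a b h = 0.
Proof.
move=> lt_cb; rewrite borderedE big1 // => j _; rewrite /unit_row.
by rewrite gtn_eqF ?mul0r // ltn_addr.
Qed.

(** Linear forms that only read the [m] entries of a row starting at column
[b]. *)
Definition row_form b m (f : (nat -> K) -> K) : Prop :=
  exists c : 'I_m -> K, forall r, f r = \sum_(j < m) r (b + j)%N * c j.

Lemma row_form_bordered a b h : row_form b h.+1 (fun r => bordered r a b h).
Proof. by exists (@border_cofactor a b h) => r; rewrite borderedE. Qed.

Lemma row_form_mulr b m f x : row_form b m f -> row_form b m (fun r => f r * x).
Proof.
case=> c fE; exists (fun j => c j * x) => r; rewrite fE mulr_suml.
by apply: eq_bigr => j _; rewrite mulrA.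
Qed.

Lemma row_formB b m f g :
  row_form b m f -> row_form b m g -> row_form b m (fun r => f r - g r).
Proof.
case=> c fE [d gE]; exists (fun j => c j - d j) => r; rewrite fE gE -sumrB.
by apply: eq_bigr => j _; rewrite mulrBr.
Qed.

Lemma row_formS b m f : row_form b m f -> row_form b m.+1 f.
Proof.
case=> c fE; exists (fun j => oapp c 0 (unlift ord_max j)) => r.
rewrite fE big_ord_recr unlift_none /= mulr0 addr0; apply: eq_bigr => j _ /=.
have -> : widen_ord (leqnSn m) j = lift ord_max j by apply: val_inj; exact/esym/lift_max.
by rewrite liftK.
Qed.

Lemma row_form_shift b m f : row_form b.+1 m f -> row_form b m.+1 f.
Proof.
case=> c fE; exists (fun j => oapp c 0 (unlift ord0 j)) => r.
rewrite fE big_ord_recl unlift_none /= mulr0 add0r; apply: eq_bigr => j _.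
by rewrite liftK /bump leq0n add1n addnS addSn.
Qed.

(** The rows b+1, ..., b+m of A together with the unit row at b form a basis of
the rows supported on the m+1 columns from b, since the matrix they form is block
triangular with diagonal blocks 1 and the matrix of the nonzero minor. *)
Lemma row_form_eq0 b m f : row_form b m.+1 f ->
    minor b.+1 b.+1 m != 0 -> f (unit_row b) = 0 ->
    (forall k, (k < m)%N -> f (A (b.+1 + k)) = 0) ->
  forall r, f r = 0.
Proof.
case=> c fE nz; rewrite fE => cb cA; have c0 : c ord0 = 0.
  rewrite -cb big_ord_recl addn0 /unit_row eqxx mul1r big1 ?addr0 // => j _.
  by rewrite lift0 -{2}[b]addn0 eqn_add2l mul0r.
suff cS j : c (lift ord0 j) = 0.
  move=> r; rewrite fE big_ord_recl c0 mulr0 add0r big1 // => j _.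
  by rewrite cS mulr0.
pose M := \matrix_(i < m, j < m) A (b.+1 + i) (b.+1 + j).
have /(congr1 (mulmx (invmx M))) : M *m \col_j c (lift ord0 j) = 0.
  apply/matrixP=> i l; rewrite !mxE; apply: etrans (cA i _) => //.
  rewrite fE big_ord_recl c0 mulr0 add0r.
  by apply: eq_bigr => k _; rewrite !mxE lift0 addnS addSn.
rewrite mulKmx ?mulmx0; last by rewrite unitmxE unitfE.
by move/matrixP/(_ j 0); rewrite !mxE.
Qed.

(** A Pluecker relation on the rows [r], b+1, ..., b+h+2. On the basis of
[row_form_eq0] both sides vanish except at the unit row and at the row b+1,
where every determinant is a solid minor. *)
Lemma bordered_up b h r : minor b.+1 b.+1 h.+1 != 0 ->
  bordered r b.+2 b h.+1 * minor b.+1 b.+1 h.+1 =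
  bordered r b.+1 b h.+1 * minor b.+2 b.+1 h.+1
  + bordered r b.+2 b.+1 h * minor b.+1 b h.+2.
Proof.
move=> nz; apply/eqP; rewrite -subr_eq0 opprD addrA; apply/eqP.
move: r; apply: (@row_form_eq0 b h.+1); rewrite ?nz //.
- do 2?apply: row_formB; apply: row_form_mulr.
  1,2: exact: row_form_bordered.
  exact/row_form_shift/row_form_bordered.
- by rewrite !bordered_unit bordered_unit0 //; ring.
move=> [|k] ltk.
- rewrite addn0 bordered_in0 // !bordered_row; ring.
- rewrite bordered_in // -[(b.+1 + k.+1)%N]addSnnS.
  rewrite !bordered_in ?mul0r ?subr0 //; exact: ltnW.
Qed.

(** A Desnanot-Jacobi identity, checked on the same basis as [bordered_up]. *)
Lemma bordered_down b h r : minor b.+1 b.+1 h.+1 != 0 ->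
  bordered r b.+2 b h * minor b.+1 b.+1 h.+1 =
  bordered r b.+1 b h.+1 * minor b.+2 b.+1 h
  + bordered r b.+2 b.+1 h * minor b.+1 b h.+1.
Proof.
move=> nz; apply/eqP; rewrite -subr_eq0 opprD addrA; apply/eqP.
move: r; apply: (@row_form_eq0 b h.+1); rewrite ?nz //.
- do 2?apply: row_formB; apply: row_form_mulr.
  + exact/row_formS/row_form_bordered.
  + exact: row_form_bordered.
  exact/row_form_shift/row_form_bordered.
- by rewrite !bordered_unit bordered_unit0 //; ring.
move=> [|k] ltk.
- rewrite addn0 bordered_in0 // !bordered_row; ring.
- rewrite bordered_in // -[(b.+1 + k.+1)%N]addSnnS.
  by rewrite !bordered_in ?mul0r ?subr0.
Qed.

(** The recurrence satisfied by the bordered minors whose rows start one below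
their columns, obtained by eliminating from [bordered_up] and [bordered_down]
those whose rows start two below. *)
Lemma bordered_step b h r : minor b.+1 b h.+1 != 0 ->
    minor b.+1 b.+1 h != 0 -> minor b.+1 b.+1 h.+1 != 0 ->
  bordered r b.+2 b.+1 h / minor b.+1 b.+1 h.+1 =
  (if h is h'.+1 then bordered r b.+2 b.+1 h' / minor b.+1 b.+1 h else 0)
  + bordered r b.+1 b h * minor b.+2 b.+1 h
    / (minor b.+1 b h.+1 * minor b.+1 b.+1 h)
  - bordered r b.+1 b h.+1 * minor b.+2 b.+1 h
    / (minor b.+1 b h.+1 * minor b.+1 b.+1 h.+1).
Proof.
move=> nz1 nz0 nz0'.
have down := bordered_down r nz0'.
have up : bordered r b.+2 b h =
    bordered r b.+1 b h * minor b.+2 b.+1 h / minor b.+1 b.+1 h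
    + (if h is h'.+1 then bordered r b.+2 b.+1 h' / minor b.+1 b.+1 h else 0)
      * minor b.+1 b h.+1.
  case: h nz1 nz0 nz0' {down} => [|h] _ nz0 _.
    by rewrite !bordered0 !minor0 mul0r addr0 divr1 mulr1.
  by apply: (mulIf nz0); rewrite bordered_up //; field.
have {down}-> : bordered r b.+2 b.+1 h = (bordered r b.+2 b h * minor b.+1 b.+1 h.+1 -
  bordered r b.+1 b h.+1 * minor b.+2 b.+1 h) / minor b.+1 b h.+1.
  by rewrite down; field.
rewrite up; move: (if h is _.+1 then _ else _) => q.
by field; rewrite ?nz1 ?nz0 ?nz0'.
Qed.
End Minors.

(** * The expansion over lattice paths *)

Section Paths.
Variables (G : zmodType) (c : bool -> nat -> nat -> G).
Implicit Types (E : nat -> seq G) (b h d i : nat).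

(** [c s b k] stands for the exponent of the prescribed minor of size [k] at
column [b] on the diagonal [s]. This is the weight of the step from
[(b, h + s)] to [(b+1, h)]; vertical steps have weight 1. *)
Definition step_exp b h (s : bool) : G :=
  c false b (h + s).+1 - c false b.+1 (h + s) + (c true b.+1 h - c true b h.+1).

Definition arrivals E b h : seq G :=
  [seq e + step_exp b h false | e <- E h] ++ [seq e + step_exp b h true | e <- E h.+1].

(** A path that ends at height [h] in column b+1 entered this column at some
height at most [h], and climbed from there. *)
Fixpoint sweep E b h : seq G :=
  (if h is h'.+1 then sweep E b h' else [::]) ++ arrivals E b h.

(** The weights of the paths from [(i, 0)] to [(i + d, h)]. For [d = 0] there is
just the vertical path, whatever [h] is. *)
Fixpoint path_exps i d : nat -> seq G :=
  if d is d'.+1 then sweep (path_exps i d') (i + d') else fun=> [:: 0].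

Lemma pathsS i d h :
  path_exps i d.+1 h.+1 = path_exps i d.+1 h ++ arrivals (path_exps i d) (i + d) h.+1.
Proof. by []. Qed.

End Paths.

Section PathSum.
Variables (G : zmodType) (K : fieldType) (mono : G -> K).
Hypotheses (mono0 : mono 0 = 1) (monoD : {morph mono : x y / x + y >-> x * y}).
Variables (A : nat -> nat -> K) (m : nat) (c : bool -> nat -> nat -> G).
Hypothesis minorE : forall (s : bool) b k, (s + b + k <= m)%N ->
  minor A (s + b) b k = (-1) ^+ (k./2) * mono (c s b k).

Lemma mono_neq0 x : mono x != 0.
Proof.
apply/eqP=> x0; have := monoD x (- x); rewrite subrr mono0 x0 mul0r.
by move/eqP; rewrite oner_eq0.
Qed.

Lemma monoB x y : mono (x - y) = mono x / mono y.
Proof. by apply: (mulIf (mono_neq0 y)); rewrite -monoD subrK divfK ?mono_neq0. Qed.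

Lemma minor_neq0 (s : bool) b k : (s + b + k <= m)%N -> minor A (s + b) b k != 0.
Proof. by move=> /minorE->; rewrite mulf_neq0 ?signr_eq0 ?mono_neq0. Qed.

Lemma mono_step b h s : mono (step_exp c b h s) =
  mono (c false b (h + s).+1) / mono (c false b.+1 (h + s)) *
  (mono (c true b.+1 h) / mono (c true b h.+1)).
Proof. by rewrite /step_exp monoD !monoB. Qed.

(** Dividing by the principal minor gives the vertical steps the weight 1. *)
Definition border_ratio i b h : K := bordered A (A i) b.+1 b h / minor A b b h.+1.

Lemma border_ratio_step i b h : (b.+1 + h < m)%N ->
  border_ratio i b.+1 h = (if h is h'.+1 then border_ratio i b.+1 h' else 0)
  + border_ratio i b h * mono (step_exp c b h false)
  + border_ratio i b h.+1 * mono (step_exp c b h true).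
Proof.
move=> ltm; have sign_cases k : (-1) ^+ k = 1 :> K \/ (-1) ^+ k = -1 :> K.
  by rewrite -signr_odd; case: odd; [right | left].
rewrite /border_ratio bordered_step.
2: by apply: (@minor_neq0 true b); lia.
2,3: by apply: (@minor_neq0 false b.+1); lia.
rewrite -!addrA; congr (_ + _); first by case: (h).
rewrite (minorE (s := true) (b := b) (k := h.+1)); last by lia.
rewrite (minorE (s := true) (b := b.+1) (k := h)); last by lia.
rewrite (minorE (s := false) (b := b) (k := h.+1)); last by lia.
rewrite (minorE (s := false) (b := b) (k := h.+2)); last by lia.
rewrite (minorE (s := false) (b := b.+1) (k := h)); last by lia.
rewrite (minorE (s := false) (b := b.+1) (k := h.+1)); last by lia.
(* Every sign is that of h/2 or of (h+1)/2, except that (h+2)/2 = h/2 + 1: this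
   one turns the difference of [bordered_step] into a sum. *)
rewrite !mono_step addn0 addn1 /= [in (-1) ^+ _.+1]exprS.
by case: (sign_cases (h./2)) => ->; case: (sign_cases (uphalf h)) => ->;
  field; rewrite ?oppr_eq0 ?oner_eq0 !mono_neq0.
Qed.

Lemma paths_sum i d h : (i + d + h < m)%N ->
  \sum_(e <- path_exps c i d h) mono e = border_ratio i (i + d) h.
Proof.
elim: d h => [|d IHd] h ltm.
  rewrite big_seq1 mono0 /border_ratio addn0 bordered_row divff //.
  by apply: (@minor_neq0 false); lia.
have arrivals_sum k : (i + d + k.+1 < m)%N ->
    \sum_(e <- arrivals c (path_exps c i d) (i + d) k) mono e =
    border_ratio i (i + d) k * mono (step_exp c (i + d) k false)
    + border_ratio i (i + d) k.+1 * mono (step_exp c (i + d) k true).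
  move=> ltk; rewrite big_cat !big_map -!IHd ?mulr_suml; try lia.
  by congr (_ + _); apply: eq_bigr => e _; rewrite monoD.
elim: h ltm => [|h IHh] ltm; rewrite addnS border_ratio_step; try lia.
  by rewrite add0r -arrivals_sum //; lia.
by rewrite -addrA pathsS big_cat IHh ?arrivals_sum ?addnS //=; lia.
Qed.
End PathSum.

(** * Distinct paths have distinct weights *)

Lemma mem_arrivals (G : zmodType) c (E : nat -> seq G) b h e :
  e \in arrivals c E b h ->
  exists (s : bool) (e0 : G), e0 \in E (h + s)%N /\ e = e0 + step_exp c b h s.
Proof.
rewrite mem_cat => /orP[] /mapP[e0 Ee0 ->].
  by exists false, e0; rewrite addn0.
by exists true, e0; rewrite addn1.
Qed.

Section Exponents.
Variable n : nat.

Definition cell_exp (u : cell n) : exponent n := [ffun w => ((val w == u) : nat)%:Z].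

(** The value 0 at the distinguished vertex reflects that its variable is 1. *)
Definition coef_at (e : exponent n) (u : cell n) : int := oapp e 0 (insub u).

Lemma coef_atD e f u : coef_at (e + f) u = coef_at e u + coef_at f u.
Proof. by rewrite /coef_at; case: insub => [w|] /=; rewrite ?addr0 ?ffunE. Qed.

Lemma coef_atB e f u : coef_at (e - f) u = coef_at e u - coef_at f u.
Proof. by rewrite /coef_at; case: insub => [w|] /=; rewrite ?subr0 ?ffunE. Qed.

Lemma coef_at0 u : coef_at 0 u = 0.
Proof. by rewrite /coef_at; case: insub => [w|] //=; rewrite ffunE. Qed.

Lemma coef_at_cell u v : u != v0 n -> coef_at (cell_exp v) u = ((u == v) : nat)%:Z.
Proof. by move=> nz; rewrite /coef_at insubT /= ffunE. Qed.

(** The cells [C s b k] of the prescribed minors have to be told apart only for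
[k > 0]: the empty minor has the trivial variable. *)
Record labelling m (C : bool -> nat -> nat -> cell n) : Prop := Labelling {
  label_neq0 : forall (s : bool) b k, (s + b + k.+1 <= m)%N -> C s b k.+1 != v0 n;
  label_inj : forall (s : bool) b k (s' : bool) b' k',
    (s + b + k.+1 <= m)%N -> (s' + b' + k' <= m)%N ->
    C s b k.+1 = C s' b' k' -> [/\ s = s', b = b' & k.+1 = k']
}.

Variables (m : nat) (C : bool -> nat -> nat -> cell n).
Hypothesis labC : labelling m C.
Let c s b k := cell_exp (C s b k).

Lemma coef_label (s : bool) b k (s' : bool) b' k' :
    (s + b + k.+1 <= m)%N -> (s' + b' + k' <= m)%N ->
  coef_at (c s' b' k') (C s b k.+1) = ([&& s == s', b == b' & k.+1 == k'] : nat)%:Z.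
Proof.
move=> le1 le2; rewrite coef_at_cell ?(label_neq0 labC) //; congr (nat_of_bool _)%:Z.
apply/eqP/and3P => [/(label_inj labC)[]// -> -> ->|[/eqP-> /eqP-> /eqP->]] //.
Qed.

(** In the columns to the right of [b], a step from [b] only involves b+1: there
the rhombus variable shows the height [h] of arrival, and the vertex variable
the height [h + s] of departure. *)
Lemma coef_step b h (s t : bool) b' k :
    (b.+1 + h < m)%N -> (b < b')%N -> (t + b' + k.+1 <= m)%N ->
  coef_at (step_exp c b h s) (C t b' k.+1) =
  if b' == b.+1 then if t then ((k.+1 == h) : nat)%:Z else - ((k.+1 == h + s)%N : nat)%:Z
  else 0.
Proof.
move=> ltm ltb lekm; rewrite /step_exp coef_atD !coef_atB !coef_label //; try by case: (s); lia.
rewrite (gtn_eqF ltb) !andbF /=; case: (b' =P b.+1) => _; rewrite ?andbF //.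
by case: t {lekm}; rewrite /= ?subr0 ?add0r ?sub0r ?addr0.
Qed.

Lemma coef_paths i d h e (t : bool) b' k : (i + d + h < m)%N -> (i + d < b')%N ->
  (t + b' + k.+1 <= m)%N -> e \in path_exps c i d h -> coef_at e (C t b' k.+1) = 0.
Proof.
elim: d h e => [|d IHd] h e ltm ltb lekm; first by rewrite inE => /eqP->; rewrite coef_at0.
have arr l : (i + d.+1 + l < m)%N -> e \in arrivals c (path_exps c i d) (i + d) l ->
    coef_at e (C t b' k.+1) = 0.
  move=> ltl /mem_arrivals[s [e0 [/IHd e0E ->]]]; rewrite coef_atD e0E; try by case: (s); lia.
  by rewrite coef_step; try lia; rewrite gtn_eqF // -addnS.
elim: h ltm => [|h IHh] ltm; first exact: arr.
by rewrite pathsS mem_cat => /orP[/IHh->//|/arr->//]; lia.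
Qed.

(** In each sweep, the weights that arrive at a new height [h] are recognized by the
exponent 1 of the rhombus variable of size [h] in the last column, and among
them the descending steps by the exponent -1 of the vertex variable of size
h+1. *)
Lemma paths_uniq i d h : (i + d + h < m)%N -> uniq (path_exps c i d h).
Proof.
elim: d h => [|d IHd] h ltm //.
have coef_new l (s : bool) e0 (t : bool) k :
    (i + d.+1 + l < m)%N -> (t + (i + d).+1 + k.+1 <= m)%N ->
    e0 \in path_exps c i d (l + s)%N ->
    coef_at (e0 + step_exp c (i + d) l s) (C t (i + d).+1 k.+1) =
    if t then ((k.+1 == l) : nat)%:Z else - ((k.+1 == l + s)%N : nat)%:Z.
  move=> ltl lek e0E; rewrite coef_atD coef_step ?eqxx //; try lia.
  by rewrite (coef_paths _ _ _ e0E) ?add0r //; case: (s); lia.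
have uniq_arrivals l : (i + d.+1 + l < m)%N -> uniq (arrivals c (path_exps c i d) (i + d) l).
  move=> ltl; rewrite cat_uniq !map_inj_uniq ?IHd ?andbT /=; try lia; try exact: addIr.
  apply/hasPn=> e /mapP[e1 Ee1 ->]; apply/mapP=> -[e0 Ee0 eq01].
  have lel : (false + (i + d).+1 + l.+1 <= m)%N by lia.
  have := coef_new l false e0 false l ltl lel; rewrite addn0 => /(_ Ee0).
  have := coef_new l true e1 false l ltl lel; rewrite addn1 => /(_ Ee1).
  by rewrite -eq01 => ->; rewrite eqxx gtn_eqF.
have old_coef l e : (i + d.+1 + l < m)%N -> e \in path_exps c i d.+1 l ->
    forall k, (l <= k)%N -> (true + (i + d).+1 + k.+1 <= m)%N ->
      coef_at e (C true (i + d).+1 k.+1) = 0.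
  elim: l => [|l IHl] ltl.
    move=> /mem_arrivals[s [e0 [Ee0 ->]]] k lek ltk; rewrite coef_new //.
  rewrite pathsS mem_cat => /orP[/IHl e0|/mem_arrivals[s [e0 [Ee0 ->]]]] k lek ltk.
    by apply: e0; lia.
  by rewrite coef_new // gtn_eqF.
elim: h ltm => [|h IHh] ltm; first exact: uniq_arrivals.
rewrite pathsS cat_uniq IHh ?uniq_arrivals //; last by lia.
rewrite andbT; apply/hasPn=> e /mem_arrivals[s [e0 [Ee0 ->]]].
have leh : (true + (i + d).+1 + h.+1 <= m)%N by lia.
apply/negP => /old_coef/(_ h (leqnn h) leh); rewrite coef_new ?eqxx //.
by move=> /(_ (ltnW _)); rewrite -addnS => /(_ ltm).
Qed.
End Exponents.

(** * The network as a table of solid minors *)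

Section Monomials.
Variables (F : fieldType) (n : nat).
Local Notation mono := (@laurent_monomial F n).

Lemma ratX_neq0 (w : indet n) : ratX F w != 0.
Proof.
rewrite /ratX tofrac_eq0; apply/eqP=> X0.
by have := msuppX F U_(enum_rank w); rewrite X0 msupp0.
Qed.

Lemma laurent_monomial0 : mono 0 = 1.
Proof. by rewrite /laurent_monomial big1 // => w _; rewrite ffunE expr0z. Qed.

Lemma laurent_monomialD : {morph mono : e f / e + f >-> e * f}.
Proof.
move=> e f; rewrite /laurent_monomial -big_split; apply: eq_bigr => w _.
by rewrite ffunE expfzDr ?ratX_neq0.
Qed.

Lemma laurent_monomial_cell (u : cell n) : mono (cell_exp u) = zvar F u.
Proof.
rewrite /laurent_monomial /zvar; case: insubP => [w _ <-|u0].
  rewrite (bigD1 w) //= ffunE eqxx expr1z big1 ?mulr1 // => w' ne.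
  by rewrite ffunE (inj_eq val_inj) (negPf ne) expr0z.
rewrite big1 // => w _; rewrite ffunE; case: eqP => [wu|_]; last by rewrite expr0z.
by case/negP: u0; rewrite -wu (valP w).
Qed.
End Monomials.

Section IntervalCells.
Variable n : nat.

Definition interval b k : {set 'I_n} := [set x : 'I_n | b <= x < b + k]%N.

(** For [k = 0] there is no rhombus; the default value [v0] then stands for the
empty minor, as its variable is 1. *)
Definition interval_cell (s : bool) b k : cell n :=
  if s then
    if [pick r : rhombus n | ((sval r).1 == b :> nat) &&
                             ((sval r).2 == (b + k)%N :> nat)]
    is Some r then inr r else v0 n
  else if [pick v : vertex n | sval v == interval b k] is Some v then inl v else v0 n.

Lemma interval0 b : interval b 0 = set0.
Proof. by apply/setP=> x; rewrite !inE; lia. Qed.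

Variant interval_cell_spec (s : bool) b k : cell n -> Type :=
| IntervalVertex (v : vertex n) of s = false & sval v = interval b k :
    interval_cell_spec s b k (inl v)
| IntervalRhombus (r : rhombus n) of s = true & (0 < k)%N
    & (sval r).1 = b :> nat & (sval r).2 = (b + k)%N :> nat :
    interval_cell_spec s b k (inr r)
| IntervalEmpty of s = true & k = 0%N : interval_cell_spec s b k (v0 n).

Lemma interval_cellP (s : bool) b k : (s + b + k <= n)%N ->
  interval_cell_spec s b k (interval_cell s b k).
Proof.
move=> len; rewrite /interval_cell; case: s len => len.
  case: pickP => [r /andP[/eqP rb /eqP rk]|none].
    by constructor => //; have := valP r; rewrite /= rb rk; lia.
  case: k len none => [|k] len none; first by constructor.
  have lb : (b < n)%N by lia.
  have lbk : (b + k.+1 < n)%N by lia.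
  have lt : ((Ordinal lb, Ordinal lbk).1 < (Ordinal lb, Ordinal lbk).2)%N by rewrite /=; lia.
  have := none (exist (fun p : 'I_n * 'I_n => (p.1 < p.2)%N) (Ordinal lb, Ordinal lbk) lt).
  by rewrite /= !eqxx.
case: pickP => [v /eqP vE|none]; first by constructor.
have cons : consecutive (interval b k).
  have lb : (b < n.+1)%N by lia.
  have lbk : (b + k < n.+1)%N by lia.
  by apply/existsP; exists (Ordinal lb); apply/existsP; exists (Ordinal lbk).
by have := none (exist (fun X => consecutive X) _ cons); rewrite /= eqxx.
Qed.

Lemma interval_inj b k b' k' : (b + k.+1 <= n)%N -> (b' + k' <= n)%N ->
  interval b k.+1 = interval b' k' -> b = b' /\ k.+1 = k'.
Proof.
move=> le1 le2 /setP eqI.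
have inI x (ltx : (x < n)%N) : (b <= x < b + k.+1)%N = (b' <= x < b' + k')%N.
  by have := eqI (Ordinal ltx); rewrite !inE.
have h1 := inI b; have h2 := inI (b + k)%N.
have h3 := inI b'; have h4 := inI (b' + k'.-1)%N. lia.
Qed.

Lemma interval_cell_labelling : labelling n interval_cell.
Proof.
split=> [s b k len|s b k s' b' k' le1 le2].
  case: interval_cellP => // v _ vE.
  apply/eqP=> -[] /(congr1 sval); rewrite vE /= -(interval0 b) => vE0.
  by case: (interval_inj _ _ vE0); lia.
case: interval_cellP => // [v s0 vE|r s1 _ rb rk]; case: interval_cellP => //.
- move=> v' s0' vE' [] /(congr1 sval); rewrite vE vE' => eqI.
  by rewrite s0 s0'; case: (interval_inj _ _ eqI) => //; lia.
- move=> s1' k0 [] /(congr1 sval); rewrite vE /= -(interval0 b) => vE0.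
  by case: (interval_inj _ _ vE0); lia.
move=> r' s1' _ rb' rk' [] rr'; rewrite -rr' rb in rb'; rewrite -rr' rk in rk'.
by split; [rewrite s1 s1' | | lia].
Qed.
End IntervalCells.

Section Network.
Variables (n : nat).

Lemma enum_interval b k : (b + k <= n)%N -> map val (enum (interval n b k)) = iota b k.
Proof.
move=> len; apply: (irr_sorted_eq ltn_trans ltnn); rewrite ?iota_ltn_sorted //.
  rewrite /(enum _) -enumT.
  rewrite sorted_map; apply: sorted_filter; first by move=> ? ? ?; apply: ltn_trans.
  by have := iota_ltn_sorted 0 n; rewrite -val_enum_ord sorted_map.
move=> x; rewrite mem_iota; apply/mapP/idP => [[i]|ltx].
  by rewrite mem_enum inE => ? ->.
have ltn : (x < n)%N by lia.
by exists (Ordinal ltn); rewrite // mem_enum inE.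
Qed.

Lemma card_interval b k : (b + k <= n)%N -> #|interval n b k| = k.
Proof. by move=> len; rewrite cardE -(size_map val) enum_interval // size_iota. Qed.

Lemma val_enum_interval (X : {set 'I_n}) b k (i : 'I_#|X|) : (b + k <= n)%N ->
  X = interval n b k -> enum_val i = (b + i)%N :> nat.
Proof.
move=> len XE; have ltk : (i < k)%N by rewrite -(card_interval len) -XE.
have enumX : map val (enum X) = iota b k by rewrite XE enum_interval.
have x0 := enum_val i; rewrite (enum_val_nth x0) -(nth_map x0 0%N val) -?cardE //.
by rewrite enumX nth_iota.
Qed.
End Network.

Lemma det_nat (K : comPzRingType) m k (M : 'M[K]_m) (N : nat -> nat -> K) :
  m = k -> (forall i j, M i j = N i j) -> \det M = \det (\matrix_(i < k, j < k) N i j).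
Proof. by move=> <- MN; congr (\det _); apply/matrixP=> i j; rewrite mxE. Qed.

Section IntervalNetwork.
Variables (K : fieldType) (n : nat) (A : 'M[K]_n.+1).

(** Indices in [nat] spare the casts between ordinals of different bounds. *)
Definition entry (i j : nat) : K := A (inord i) (inord j).

Lemma entryE (i j : 'I_n.+1) : A i j = entry i j.
Proof. by rewrite /entry !inord_val. Qed.

Lemma network_interval (s : bool) b k : (s + b + k <= n.+1)%N ->
  network A (interval_cell n.+1 s b k) = (-1) ^+ (k./2) * minor entry (s + b) b k.
Proof.
move=> len; case: interval_cellP => // [v s0 vE|r s1 k0 rb rk|s1 k0] /=.
- subst s; have card : #|sval v| = k by rewrite vE card_interval.
  rewrite {1}card; congr (_ * _).
  apply: (det_nat (N := fun x y => entry (b + x) (b + y))) => // i j.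
  by rewrite mxE entryE !(val_enum_interval _ _ vE).
- case: r rb rk => -[i j] /= ltij ib jk; subst s.
  have SX : j |: between i j = interval n.+1 b.+1 k.
    by apply/setP=> x; rewrite !inE -val_eqE /=; lia.
  have SY : i |: between i j = interval n.+1 b k.
    by apply/setP=> x; rewrite !inE -val_eqE /=; lia.
  have card : #|j |: between i j| = k by rewrite SX card_interval //; lia.
  have -> : uphalf #|between i j| = k./2.
    by rewrite -card cardsU1 !inE ltnn andbF.
  congr (_ * _).
  apply: (det_nat (N := fun x y => entry (b.+1 + x) (b + y))) => // x y.
  rewrite castmxE mxE entryE (val_enum_interval _ _ SX) ?(val_enum_interval _ _ SY) //; lia.
rewrite k0 {1}cards0 minor0; congr (_ * _).
have det1 m (M : 'M[K]_m) : m = 0%N -> \det M = 1 by move=> m0; subst m; exact: det_mx00.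
by rewrite det1 ?cards0.
Qed.
End IntervalNetwork.

(** * Counting domino tilings *)

Local Open Scope nat_scope.

Section Tilings.
Variable n : nat.
Implicit Types (R D : {set square n}) (s t : square n).

Lemma adjacentC s t : adjacent s t = adjacent t s.
Proof.
rewrite /adjacent ![_ == t.1]eq_sym ![_ == t.2]eq_sym.
by congr (_ && _ || _ && _); rewrite orbC.
Qed.

Lemma adjacent_irr s : adjacent s s = false.
Proof. by rewrite /adjacent !eqxx /= (gtn_eqF (ltnSn _)) (gtn_eqF (ltnSn _)). Qed.

Lemma domino_pair s t : adjacent s t -> domino [set s; t].
Proof. by move=> adj; apply/existsP; exists s; apply/existsP; exists t; rewrite adj eqxx. Qed.

Lemma mem_domino D s : domino D -> s \in D -> exists2 t, adjacent s t & D = [set s; t].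
Proof.
case/existsP=> a /existsP[b /andP[adj /eqP->]]; rewrite !inE => /orP[]/eqP->.
  by exists b.
by exists a; rewrite 1?adjacentC // setUC.
Qed.

Lemma card_tilings_through R D : domino D -> D \subset R ->
  #|[set P in domino_tilings R | D \in P]| = #|domino_tilings (R :\: D)|.
Proof.
move=> domD sDR; have D0 : D != set0.
  case/existsP: (domD) => a /existsP[b /andP[_ /eqP->]].
  by apply/set0Pn; exists a; rewrite !inE eqxx.
have notin P : partition P (R :\: D) -> D \notin P.
  move=> partP; apply/negP=> DP; have /set0Pn[x xD] := D0.
  by have /subsetP/(_ x xD) := partitionS partP DP; rewrite inE xD.
rewrite -(@card_in_imset _ _ (fun P => D |: P) (mem (domino_tilings (R :\: D)))).
  apply: eq_card => P; apply/idP/imsetP => [|[Q]].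
    rewrite !inE => /andP[/andP[partP /forall_inP domP] DP].
    exists (P :\ D); last by rewrite setD1K.
    rewrite !inE partitionD1 //=; apply/forall_inP=> E /setD1P[_]; exact: domP.
  rewrite !inE => /andP[partQ /forall_inP domQ] ->.
  have -> : partition (D |: Q) R.
    rewrite -(setID R D) (setIidPr sDR) partitionU1 //.
    by rewrite disjoints_subset setCD subsetUr.
  rewrite setU11 andbT /=; apply/forall_inP=> E /setU1P[->//|]; exact: domQ.
move=> P Q; rewrite !inE => /andP[partP _] /andP[partQ _] eqPQ.
by rewrite -(setU1K (notin P partP)) eqPQ setU1K ?notin.
Qed.

(** The domino that covers [s] is determined by its other square. *)
Lemma card_tilings_peel R s : s \in R ->
  #|domino_tilings R| = \sum_(t in R | adjacent s t) #|domino_tilings (R :\: [set s; t])|.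
Proof.
move=> sR; pose mate (P : {set {set square n}}) :=
  odflt s [pick t | adjacent s t && ([set s; t] \in P)].
have mateP P : P \in domino_tilings R ->
    [&& mate P \in R, adjacent s (mate P) & [set s; mate P] \in P].
  rewrite inE => /andP[partP /forall_inP domP]; rewrite /mate.
  case: pickP => [t /andP[adj tP] | none] /=.
    rewrite adj tP !andbT; have /subsetP-> // := partitionS partP tP.
    by rewrite !inE eqxx orbT.
  have := sR; rewrite -{1}(cover_partition partP) => /bigcupP[D DP sD].
  have [t adj Dt] := mem_domino (domP D DP) sD.
  by have := none t; rewrite adj -Dt DP.
rewrite -sum1_card (partition_big mate (fun t => (t \in R) && adjacent s t)) => [|P]; last first.
  by case/mateP/and3P=> -> ->.
apply: eq_bigr => t /andP[tR adj]; rewrite -card_tilings_through ?domino_pair //; last first.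
  by apply/subsetP=> x; rewrite !inE => /orP[]/eqP->.
rewrite -sum1_card; apply: eq_bigl => P; rewrite [RHS]inE; apply: andb_id2l => PR.
have /and3P[_ adj' PP] := mateP P PR; apply/eqP/idP => [<-//|tP].
have := PR; rewrite inE => /andP[/partition_trivIset/trivIsetP triv _].
case: (altP ([set s; mate P] =P [set s; t])) => [/setP/(_ t)|/(triv _ _ PP tP)].
  rewrite !inE eqxx orbT => /orP[]/eqP // ts.
  by rewrite ts adjacent_irr in adj.
by move=> /disjointFr/(_ (set21 _ _)); rewrite set21.
Qed.

Lemma card_tilings0 : #|domino_tilings (set0 : {set square n})| = 1.
Proof.
rewrite (_ : domino_tilings set0 = [set set0]) ?cards1 //; apply/setP=> P.
rewrite !inE partition_set0; apply/andP/eqP => [[/eqP->//]|->].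
by split=> //; apply/forall_inP=> D; rewrite inE.
Qed.
End Tilings.

(** Tilings as perfect matchings between two copies of an acyclic graph. *)
Section Matchings.
Variables (n : nat) (V : finType) (white black : V -> square n) (V0 : {set V}).
Variables (edge : rel V) (rank : V -> nat).
Hypotheses (white_inj : {in V0 &, injective white}) (black_inj : {in V0 &, injective black}).
Hypothesis white_black : {in V0 &, forall x y, white x != black y}.
Hypothesis adjacent_bw :
  {in V0 &, forall x y, adjacent (black y) (white x) = (x == y) || edge x y}.
Hypothesis adjacent_bb : {in V0 &, forall x y, adjacent (black x) (black y) = false}.
Hypothesis edge_rank : {in V0 &, forall x y, edge x y -> rank x < rank y}.
Implicit Types (U X Y : {set V}) (s t x y : V).

Definition region X Y : {set square n} := white @: X :|: black @: Y.

Lemma regionD X Y x y : X \subset V0 -> Y \subset V0 -> x \in X -> y \in Y ->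
  region X Y :\: [set black y; white x] = region (X :\ x) (Y :\ y).
Proof.
move=> /subsetP sX /subsetP sY xX yY.
apply/setP=> u; rewrite in_setD in_set2 negb_or !in_setU andbC.
apply/andP/orP => [[/orP[]/imsetP[z zX ->] /andP[nb nw]]|[]/imsetP[z /setD1P[ne zX] ->]].
- by left; apply: imset_f; rewrite !inE zX andbT; apply: contraNneq nw => ->.
- by right; apply: imset_f; rewrite !inE zX andbT; apply: contraNneq nb => ->.
- split; first by apply/orP; left; apply: imset_f.
  apply/andP; split; first by apply: white_black; [apply: sX | apply: sY].
  by apply: contraNneq ne => /white_inj->; rewrite ?sX.
split; first by apply/orP; right; apply: imset_f.
apply/andP; split; last by rewrite eq_sym; apply: white_black; [apply: sX | apply: sY].
by apply: contraNneq ne => /black_inj->; rewrite ?sY.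
Qed.

Lemma card_region_peel X Y t : X \subset V0 -> Y \subset V0 -> t \in Y ->
  #|domino_tilings (region X Y)| =
  \sum_(x in X | (x == t) || edge x t) #|domino_tilings (region (X :\ x) (Y :\ t))|.
Proof.
move=> sX sY tY; have tV : t \in V0 := subsetP sY t tY.
have xV x : x \in X -> x \in V0 := subsetP sX x.
rewrite (@card_tilings_peel _ _ (black t)); last by rewrite inE imset_f ?orbT.
transitivity (\sum_(u in white @: X | adjacent (black t) u)
    #|domino_tilings (region X Y :\: [set black t; u])|).
  apply: eq_bigl => u; rewrite inE; case: (boolP (u \in white @: X)) => //= _.
  apply/negbTE/andP=> -[/imsetP[y yY ->]].
  by rewrite adjacent_bb // (subsetP sY).
rewrite big_mkcondr big_imset /=; last by move=> x y /xV xV0 /xV yV0; apply: white_inj.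
rewrite [RHS]big_mkcondr; apply: eq_bigr => x xX.
by rewrite regionD // adjacent_bw // xV.
Qed.

(** A site of least rank in [U] has no predecessor there, so that its black square
must be matched with its own white square; induct. *)
Lemma card_region_full U : U \subset V0 -> #|domino_tilings (region U U)| = 1.
Proof.
elim: {U}_.+1 {-2}U (ltnSn #|U|) => // m IHm U ltm sU.
have [->|[t0 t0U]] := set_0Vmem U; first by rewrite /region !imset0 setU0 card_tilings0.
case: (arg_minnP rank t0U) => t tU' t_min; have tU : t \in U := tU'.
rewrite (card_region_peel _ _ tU) //.
rewrite (big_pred1 t) => [|x].
  apply: IHm; last exact: subset_trans (subsetDl _ _) sU.
  by rewrite (cardsD1 t) tU in ltm.
rewrite /= -[x \in mem U]/(x \in U); case: (altP (x =P t)) => [->|_ /=]; first by rewrite tU.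
apply/andP=> -[xU]; rewrite /= => /edge_rank.
by rewrite ltnNge t_min // => /(_ (subsetP sU x xU) (subsetP sU t tU)).
Qed.

(** The white square of [t] being removed, the black square of [t] must be
matched with the white square of a predecessor [x]. Deleting this domino leaves
[U] without [t], where now the white square of [x] is missing. The set [U] must
contain everything below [t] in order not to lose predecessors. *)
Lemma card_region_paths (count : V -> nat) s : s \in V0 -> count s = 1 ->
    {in V0, forall t, t != s -> count t = \sum_(x in V0 | edge x t) count x} ->
  forall U t, U \subset V0 -> s \in U -> t \in U ->
    {in V0, forall x, rank x < rank t -> x \in U} ->
  #|domino_tilings (region (U :\ t) (U :\ s))| = count t.
Proof.
move=> sV count_s countE U.
elim: {U}_.+1 {-2}U (ltnSn #|U|) => // m IHm U ltm t sU sInU tU Ut.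
have sUD (x : V) : U :\ x \subset V0 by apply: subset_trans sU; apply: subsetDl.
have tV : t \in V0 := subsetP sU t tU.
have [->|ts] := eqVneq t s; first by rewrite card_region_full ?count_s.
rewrite (@card_region_peel _ _ t) ?sUD // ?inE ?ts //.
rewrite countE //; transitivity (\sum_(x in U :\ t | edge x t) count x); last first.
  apply: eq_bigl => x; rewrite !inE; apply: andb_id2r => xt.
  apply/andP/idP => [[_ /(subsetP sU)//]|xV]; have ltxt := edge_rank xV tV xt.
  by split; [apply: contraTneq ltxt => ->; rewrite ltnn | apply: Ut].
apply: eq_big => [x|x /andP[]]; rewrite !inE; first by case: eqP.
move=> /andP[xt xU]; rewrite (negPf xt) /= => xt_edge.
have -> : U :\ s :\ t = U :\ t :\ s by rewrite !setDDl setUC.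
apply: IHm => //; rewrite ?inE ?xt ?xU ?[s == t]eq_sym ?ts ?sInU //.
  by rewrite (cardsD1 t) tU in ltm.
move=> y yV ltyx; rewrite !inE; have ltxt := edge_rank (subsetP sU x xU) tV xt_edge.
by rewrite Ut ?(ltn_trans ltyx) // andbT; apply: contraTneq ltyx => ->; rewrite -leqNgt ltnW.
Qed.
End Matchings.

(** * The half-aztec diamond as a triangle of sites *)

Section Sites.
Variables (n o m : nat).
Hypothesis offset : o + m = n.+1.
Definition site := ('I_m * 'I_m)%type.
Implicit Types x y s t : site.

Definition triangle : {set site} := [set x : site | x.1 + x.2 < m].

(** Black squares ([e = false]) and white ones are shifted by [o] columns, which
is 1 when the outer layer has been deleted. *)
Definition square_of (e : bool) (x : site) : square n.+1 :=
  ((inord (o + (x.1.*2 + x.2 + e)) : 'I_(n.*2.+1).+1), inord x.2).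

(** The steps of the lattice paths: up, horizontal, down. *)
Definition arrow : rel site := [rel x y : site |
  [|| (x.1 == y.1 :> nat) && (x.2.+1 == y.2),
      (x.1.+1 == y.1) && (x.2 == y.2 :> nat) |
      (x.1.+1 == y.1) && (x.2 == y.2.+1 :> nat)]].

Definition site_rank (x : site) := x.1 * m + x.2.

Lemma square_ofE e x : x \in triangle ->
  ((square_of e x).1 = o + (x.1.*2 + x.2 + e) :> nat) * ((square_of e x).2 = x.2 :> nat).
Proof.
rewrite inE => ltm; split; last by apply: inordK; lia.
by apply: (@inordK n.*2.+1); case: e; lia.
Qed.

Lemma square_eq (u v : square n.+1) :
  (u == v) = ((u.1 : nat) == v.1) && ((u.2 : nat) == v.2).
Proof. by rewrite -pair_eqE. Qed.

Lemma square_of_eq e f : {in triangle &, forall x y,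
  (square_of e x == square_of f y) = (e == f) && (x == y)}.
Proof.
move=> x y xT yT; rewrite square_eq !square_ofE // -pair_eqE /= -!val_eqE /=.
case: e; case: f; rewrite /=; lia.
Qed.

Lemma square_of_inj e : {in triangle &, injective (square_of e)}.
Proof. by move=> x y xT yT /eqP; rewrite square_of_eq // eqxx => /eqP. Qed.

Lemma white_neq_black : {in triangle &, forall x y, square_of true x != square_of false y}.
Proof. by move=> x y xT yT; rewrite square_of_eq. Qed.

Lemma adjacent_nat (u v : square n.+1) : adjacent u v =
  ((u.2 == v.2 :> nat) && ((u.1.+1 == v.1 :> nat) || (v.1.+1 == u.1 :> nat))) ||
  ((u.1 == v.1 :> nat) && ((u.2.+1 == v.2 :> nat) || (v.2.+1 == u.2 :> nat))).
Proof. by []. Qed.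

Lemma adjacent_black_white : {in triangle &, forall x y,
  adjacent (square_of false y) (square_of true x) = (x == y) || arrow x y}.
Proof.
move=> x y xT yT; rewrite adjacent_nat !square_ofE // /arrow -pair_eqE /= -!val_eqE /=.
by lia.
Qed.

Lemma adjacent_black_black : {in triangle &, forall x y,
  adjacent (square_of false x) (square_of false y) = false}.
Proof. by move=> x y xT yT; rewrite adjacent_nat !square_ofE //; lia. Qed.

Lemma arrow_rank : {in triangle &, forall x y, arrow x y -> site_rank x < site_rank y}.
Proof.
move=> [[a la] [b lb]] [[a' la'] [b' lb']]; rewrite !inE /site_rank /arrow /= => l1 l2.
by case/or3P=> /andP[/eqP<- /eqP E]; rewrite ?mulSn; lia.
Qed.

Lemma mem_region s t (u : square n.+1) : s \in triangle -> t \in triangle ->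
  (u \in region (square_of true) (square_of false) (triangle :\ t) (triangle :\ s)) =
  [&& o + u.2 <= u.1, o + u.1 + u.2 < n.+1.*2, u != square_of false s
    & u != square_of true t].
Proof.
move=> sT tT; rewrite inE; apply/orP/and4P => [[]/imsetP[x /setD1P[ne xT] ->]|].
- rewrite !square_of_eq // !eqxx ne !square_ofE //; move: (xT); rewrite inE => ltm.
  by split=> //; lia.
- rewrite !square_of_eq // !eqxx ne !square_ofE //; move: (xT); rewrite inE => ltm.
  by split=> //; lia.
move=> [le1 le2 nes net].
have l1 : (u.1 - o - u.2)./2 < m by lia.
have l2 : u.2 < m by lia.
pose x : site := (Ordinal l1, Ordinal l2).
have xT : x \in triangle by rewrite inE /=; lia.
have uE : u = square_of (odd (u.1 - o - u.2)) x.
  by apply/eqP; rewrite square_eq !square_ofE //=; lia.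
case: (odd _) uE => uE; [left | right]; apply/imsetP; exists x => //; rewrite in_setD1 xT andbT.
  by apply: contraNneq net => <-; rewrite uE.
by apply: contraNneq nes => <-; rewrite uE.
Qed.

Section Count.
Variables (G : GRing.Zmodule.type) (c : bool -> nat -> nat -> G) (i : nat).

(** The paths start in column [i], hence do not reach the columns before it. *)
Definition path_count (k h : nat) : nat :=
  if k < i then 0 else size (path_exps c i (k - i) h).

Lemma sum_site1 (f : nat -> nat -> nat) (P : pred site) a b : a + b < m ->
    {in triangle, forall x, P x = (x.1 == a :> nat) && (x.2 == b :> nat)} ->
  \sum_(x in triangle | P x) f x.1 x.2 = f a b.
Proof.
move=> ltm PE; have la : a < m by lia.
have lb : b < m by lia.
rewrite (big_pred1 (Ordinal la, Ordinal lb : 'I_m)) // => x.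
rewrite /= -pair_eqE /= -!val_eqE /=.
case: (boolP (x \in triangle)) => /= [/PE //|]; rewrite inE => nlt.
by apply/esym/andP=> -[/eqP xa /eqP xb]; rewrite xa xb ltm in nlt.
Qed.

Lemma sum_arrows (f : nat -> nat -> nat) t : t \in triangle ->
  \sum_(x in triangle | arrow x t) f x.1 x.2 =
  (if t.2 : nat is h.+1 then f t.1 h else 0) +
  (if t.1 : nat is k.+1 then f k t.2 + f k t.2.+1 else 0).
Proof.
case: t => -[k lk] [h lh]; rewrite inE /= => ltm.
rewrite (bigID (fun x : site => x.1 == k :> nat)) /=; congr (_ + _).
  case: h lh ltm => [|h] lh ltm.
    by rewrite big_pred0 // => -[[a la] [b lb]]; rewrite !inE /arrow /=; lia.
  under eq_bigl do rewrite -andbA.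
  by apply: sum_site1 => [|[[a la] [b lb]] _]; rewrite /arrow /=; lia.
rewrite (bigID (fun x : site => x.2 == h :> nat)) /=.
case: k lk ltm => [|k] lk ltm.
  by rewrite !big_pred0 // => -[[a la] [b lb]]; rewrite !inE /arrow /=; lia.
congr (_ + _); under eq_bigl do rewrite -!andbA.
  by apply: sum_site1 => [|[[a la] [b lb]] _]; rewrite /arrow /=; lia.
by apply: sum_site1 => [|[[a la] [b lb]] _]; rewrite /arrow /=; lia.
Qed.

Lemma size_arrivals E b h : size (arrivals c E b h) = size (E h) + size (E h.+1).
Proof. by rewrite size_cat !size_map. Qed.

Lemma path_countE t : t \in triangle -> (t.1 != i :> nat) || (0 < t.2) ->
  path_count t.1 t.2 = \sum_(x in triangle | arrow x t) path_count x.1 x.2.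
Proof.
move=> tT ti; rewrite (sum_arrows path_count tT).
case: t tT ti => -[k lk] [h lh] /= _ ti; rewrite /path_count.
have [lt|le] := ltnP k i.
  by case: h {lh ti} => [|h]; case: k {lk} lt => [|k] // lt; rewrite !ifT //; lia.
have [ki|ne] := eqVneq k i.
  subst k; rewrite subnn /=; case: h lh ti => [|h] _; first by rewrite eqxx.
  by case: (i) => [|k] //; rewrite ltnSn.
have -> : k = k.-1.+1 by lia.
rewrite !ifF; try lia; rewrite subSn; last by lia.
case: h {lh ti} => [|h]; first by rewrite /= size_arrivals.
by rewrite pathsS size_cat size_arrivals.
Qed.

Lemma card_tilings_paths s t : s \in triangle -> t \in triangle ->
    s.1 = i :> nat -> s.2 = 0 :> nat -> 
  #|domino_tilings (region (square_of true) (square_of false)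
                           (triangle :\ t) (triangle :\ s))| = path_count t.1 t.2.
Proof.
move=> sT tT si s0.
apply: (card_region_paths (@square_of_inj true) (@square_of_inj false)
  white_neq_black adjacent_black_white adjacent_black_black arrow_rank
  (count := fun x : site => path_count x.1 x.2)) => //.
- by rewrite /path_count si s0 ltnn subnn.
move=> u uT us; apply: path_countE => //; move: us; rewrite -pair_eqE /= -!val_eqE /= si s0.
by rewrite negb_and lt0n.
Qed.
End Count.
End Sites.

(** * Assembling the expansion and the count *)

Local Open Scope ring_scope.

Lemma bijection_of_card (S T : finType) : #|S| = #|T| -> exists f : S -> T, bijective f.
Proof.
move=> eqST; exists (fun x => enum_val (cast_ord eqST (enum_rank x))).
exists (fun y => enum_val (cast_ord (esym eqST) (enum_rank y))) => x.
  by rewrite enum_valK cast_ordK enum_rankK.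
by rewrite enum_valK cast_ordKV enum_rankK.
Qed.

Section Assembly.
Variables (F : fieldType) (n : nat).

Lemma laurent_of_exponents (s : seq (exponent n)) : uniq s ->
  exists L : laurent_poly F n,
    [/\ laurent_eval L = \sum_(e <- s) laurent_monomial F e,
        forall e, e \in finsupp L -> L e = 1 & #|{: finsupp L}| = size s].
Proof.
move=> uniq_s; pose S : {fset exponent n} := [fset e in s]%fset.
pose L : laurent_poly F n := [fsfun e in S => 1 | 0].
have memS e : (e \in S) = (e \in s) by rewrite in_fset.
have LE e : L e = if e \in s then 1 else 0 by rewrite /L fsfunE memS.
have suppL e : (e \in finsupp L) = (e \in s).
  by rewrite mem_finsupp LE; case: ifP => _; rewrite ?oner_eq0 ?eqxx.
have perm_s : perm_eq (finsupp L) s by apply: uniq_perm => //; apply: fset_uniq.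
exists L; split.
- rewrite /laurent_eval (perm_big _ perm_s) /=; apply: eq_big_seq => e es.
  by rewrite LE es /ratC mpolyC1 tofrac1 mul1r.
- by move=> e; rewrite suppL LE => ->.
by rewrite -cardfE (perm_size perm_s).
Qed.

(** Stated for any matrix and any labelling of its minors, to be used once for
the entries on and above the diagonal, and once for those below it. *)
Lemma path_expansion (B : nat -> nat -> ratfun F n) m (C : bool -> nat -> nat -> cell n) :
    labelling m C ->
    (forall (s : bool) b k, (s + b + k <= m)%N ->
       minor B (s + b) b k = (-1) ^+ (k./2) * zvar F (C s b k)) ->
  forall i j (R : {set square n}), (i <= j < m)%N ->
    #|domino_tilings R| = size (path_exps (fun s b k => cell_exp (C s b k)) i (j - i) 0) ->
  exists L : laurent_poly F n,
    [/\ B i j = laurent_eval L, (forall e : exponent n, e \in finsupp L -> L e = 1)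
      & exists f : finsupp L -> {T | T \in domino_tilings R}, bijective f].
Proof.
move=> labC minorB i j R /andP[leij ltjm] cardR.
pose c (s : bool) b k := cell_exp (C s b k).
have minorE (s : bool) b k : (s + b + k <= m)%N ->
    minor B (s + b) b k = (-1) ^+ (k./2) * laurent_monomial F (c s b k).
  by move=> le; rewrite minorB // laurent_monomial_cell.
have ltm : (i + (j - i) + 0 < m)%N by lia.
have uniq_p := paths_uniq labC ltm.
have := paths_sum (@laurent_monomial0 F n) (@laurent_monomialD F n) minorE ltm.
rewrite subnKC // /border_ratio => sumE.
have nz : minor B j j 1 != 0.
  apply: (minor_neq0 (@laurent_monomial0 F n) (@laurent_monomialD F n) minorE (s := false)).
  by lia.
pose s := [seq e + c false j 1%N | e <- path_exps c i (j - i) 0].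
have [|L [LE L1 Lcard]] := @laurent_of_exponents s.
  by rewrite map_inj_uniq //; apply: addIr.
exists L; split=> //; last first.
  by apply: bijection_of_card; rewrite Lcard size_map card_sig -cardR; apply: eq_card.
rewrite LE big_map; under eq_bigr do rewrite laurent_monomialD.
rewrite -mulr_suml sumE -[laurent_monomial _ _]mul1r -(expr0 (-1)).
rewrite -(minorE false j 1%N); last by lia.
by rewrite divfK // bordered0.
Qed.
End Assembly.

Section Regions.
Variables (n : nat) (G : zmodType) (c : bool -> nat -> nat -> G).

Lemma card_tilings_upper (i j : 'I_n.+1) : (i <= j)%N ->
  #|domino_tilings (entry_region i j)| = size (path_exps c i (j - i) 0).
Proof.
move=> leij; pose s : site n.+1 := (i, ord0); pose t : site n.+1 := (j, ord0).
have sT : s \in triangle n.+1 by rewrite inE addn0.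
have tT : t \in triangle n.+1 by rewrite inE addn0.
have := card_tilings_paths (add0n n.+1) c sT tT erefl erefl.
rewrite /path_count /= ltnNge leij /= => <-; congr #|pred_of_set (domino_tilings _)|.
apply/setP=> u; rewrite (mem_region (add0n n.+1)) // /entry_region leij !inE !square_eq.
by rewrite !(square_ofE (add0n n.+1)) //=; have := ltn_ord u.1; lia.
Qed.

Lemma card_tilings_lower (i j : 'I_n.+1) : (j < i)%N ->
  #|domino_tilings (entry_region i j)| = size (path_exps c j (i.-1 - j) 0).
Proof.
move=> ltji; have lti := ltn_ord i.
have lj : (j < n)%N by lia.
have li : (i.-1 < n)%N by lia.
have l0 : (0 < n)%N by lia.
pose s : site n := (Ordinal lj, Ordinal l0); pose t : site n := (Ordinal li, Ordinal l0).
have sT : s \in triangle n by rewrite inE addn0.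
have tT : t \in triangle n by rewrite inE addn0.
have := card_tilings_paths (add1n n) c sT tT erefl erefl.
rewrite /path_count /= ifF; last by lia.
move=> <-; congr #|pred_of_set (domino_tilings _)|.
apply/setP=> u; rewrite (mem_region (add1n n)) // /entry_region leqNgt ltji !inE !square_eq.
by rewrite !(square_ofE (add1n n)) //=; have := ltn_ord u.1; lia.
Qed.
End Regions.

Theorem theorem4p4 (F : fieldType) (n : nat) (n_ge2 : (2 <= n)%N)
    (A : 'M[ratfun F n]_n) (A_network : forall u : cell n, network A u = zvar F u) :
  forall i j : 'I_n,
    exists L : laurent_poly F n,
      [/\ A i j = laurent_eval L,
          (forall e : exponent n, e \in finsupp L -> L e = 1)
        & exists f : finsupp L -> {T | T \in domino_tilings (entry_region i j)},
            bijective f].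
Proof.
case: n n_ge2 A A_network => // n _ A A_network i j.
have sign_sqr k : (-1) ^+ k * (-1) ^+ k = 1 :> ratfun F n.+1.
  by rewrite -exprD addnn -muln2 exprM sqrr_sign.
have minorE (s : bool) b k : (s + b + k <= n.+1)%N ->
    minor (entry A) (s + b) b k = (-1) ^+ (k./2) * zvar F (interval_cell n.+1 s b k).
  by move=> le; rewrite -A_network network_interval // mulrA sign_sqr mul1r.
have labC := interval_cell_labelling n.+1.
have [leij|ltji] := leqP i j.
  rewrite entryE; apply: (path_expansion labC minorE).
    by rewrite leij ltn_ord.
  exact: card_tilings_upper.
(* The matrix [B] swaps rows with columns and moves one row down, which turns the
   diagonal [s] into the diagonal [~~ s] and its interval from [b] into the one
   from [s + b]. *)
pose C' (s : bool) b k := interval_cell n.+1 (~~ s) (s + b) k.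
pose B x y := entry A y.+1 x.
have -> : A i j = B j i.-1 by rewrite entryE /B prednK //; lia.
apply: (@path_expansion _ _ B n C').
- split=> [s b k le|s b k s' b' k' le le' /(label_inj labC)[]].
  + by apply: (label_neq0 labC); case: s le => /=; lia.
  + by case: s le => /=; lia.
  + by case: s' le' => /=; lia.
  by case: s le => le; case: s' le' => le' // _ ? ?; split=> //; lia.
- move=> s b k le; rewrite -minorE; last by case: s le => /=; lia.
  rewrite /minor -det_tr; congr (\det _); apply/matrixP=> x y; rewrite !mxE /B.
  by congr (entry A _ _); case: s {le} => /=; lia.
- by have := ltn_ord i; lia.
exact: card_tilings_lower.
Qed.
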